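(* Let $A$ and $N$ be abelian groups. Then the sequence $$0\to H^2_{ab}(A,N)\xrightarrow{s_2} H^2(A,N)\xrightarrow{\tau_2} H^2(\mathrm{Tot}^*(D^{*,*}(A,N)))\xrightarrow{\iota} H^3_{ab}(A,N)\xrightarrow{s_3} H^3(A,N)\xrightarrow{\tau_3} H^3(\mathrm{Tot}^*(D^{*,*}(A,N)))$$ is exact.
   Context: Abelian groups are written additively; $A$ acts trivially on $N$. $H^n(A,N)$ is ordinary group cohomology, computed by normalized inhomogeneous cochains (cochains vanishing when some argument is $0$); non-normalized cochains give the same groups, so every inhomogeneous cocycle determines a class. Abelian cohomology (Eilenberg–MacLane), in low degrees. $C^1_{ab}(A,N)$ and $C^2_{ab}(A,N)$ are the groups of all maps $A\to N$ and $A\times A\to N$; $C^3_{ab}(A,N)$ is the group of all pairs $(\omega,c)$ of maps $\omega:A^3\to N$, $c:A\times A\to N$. For $g\in C^1_{ab}$, $\partial g(x,y)=g(y)-g(x+y)+g(x)$. For $f\in C^2_{ab}$, $\partial f=(\omega_f,c_f)$ with $\omega_f(x,y,z)=f(y,z)-f(x+y,z)+f(x,y+z)-f(x,y)$ and $c_f(x,y)=f(x,y)-f(y,x)$. $Z^2_{ab}(A,N)=\{f:\partial f=0\}$, $B^2_{ab}(A,N)=\{\partial g\}$, $H^2_{ab}=Z^2_{ab}/B^2_{ab}$. $Z^3_{ab}(A,N)$ consists of the pairs $(\omega,c)$ with, for all $x,y,z,t\in A$: (i) $\omega(y,z,t)-\omega(x+y,z,t)+\omega(x,y+z,t)-\omega(x,y,z+t)+\omega(x,y,z)=0$;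 (ii) $c(x,z)-c(x,y+z)+c(x,y)+\omega(x,y,z)-\omega(y,x,z)+\omega(y,z,x)=0$; (iii) $c(y,z)-c(x+y,z)+c(x,z)-\omega(x,y,z)+\omega(x,z,y)-\omega(z,x,y)=0$. $B^3_{ab}(A,N)=\{\partial f: f\in C^2_{ab}(A,N)\}$ and $H^3_{ab}=Z^3_{ab}/B^3_{ab}$. Double complex. $D^{p,q}(A,N)$ is the group of all maps $A^p\times A^q\to N$ (values written $F(g_1,\dots,g_p\|k_1,\dots,k_q)$) for $p,q>0$, and $0$ if $p=0$ or $q=0$. The horizontal differential $\delta_h:D^{p,q}\to D^{p+1,q}$ and vertical differential $\delta_v:D^{p,q}\to D^{p,q+1}$ are the standard inhomogeneous group cohomology differentials (trivial action) in the first $p$ and in the last $q$ variables respectively; $\mathrm{Tot}^*$ is the total complex, with differential $\delta_h+(-1)^p\delta_v$ on $D^{p,q}$. In low degrees: $\mathrm{Tot}^1=0$, $\mathrm{Tot}^2=D^{1,1}$, $\mathrm{Tot}^3=D^{1,2}\oplus D^{2,1}$; $H^2(\mathrm{Tot}^*(D^{*,*}(A,N)))=\mathrm{Hom}(A^{\otimes 2},N)$ (bilinear maps $A\times A\to N$). Maps. $s_2$ sends the class of $f\in Z^2_{ab}(A,N)$ to its class in $H^2(A,N)$; $s_3$ sends the class of $(\omega,c)$ to the class of $\omega$. $\iota$ sends a bilinear map $c$ to the class of $(0,c)$. $\tau_2$ sends the class of $\alpha$ to the bilinear map $(x,y)\mapsto\alpha(x,y)-\alpha(y,x)$. $\tau_3$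 sends the class of $\omega$ to the class of $(\alpha_\omega,\beta_\omega)\in D^{1,2}\oplus D^{2,1}$, where $\alpha_\omega(x\|y,z)=\omega(x,y,z)-\omega(y,x,z)+\omega(y,z,x)$ and $\beta_\omega(x,y\|z)=\omega(x,y,z)-\omega(x,z,y)+\omega(z,x,y)$. *)

(* Defs.v *)
From HB Require Import structures.
From mathcomp Require Import all_boot all_order all_algebra.
From mathcomp Require Import boolp functions.

Set Implicit Arguments.
Unset Strict Implicit.
Unset Printing Implicit Defensive.
Import GRing.Theory.
Local Open Scope ring_scope.
Local Open Scope quotient_scope.

(* A reflexive decision procedure for identities in abelian groups; it is only
   used to check that the maps below are well defined. *)
Inductive zexp := ZVar of nat | ZZero | ZAdd of zexp & zexp | ZOpp of zexp.

Fixpoint zeval (V : zmodType) (env : seq V) (e : zexp) : V :=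
  match e with
  | ZVar i => env`_i
  | ZZero => 0
  | ZAdd e1 e2 => zeval env e1 + zeval env e2
  | ZOpp e1 => - zeval env e1
  end.

Fixpoint zcoef (e : zexp) (i : nat) : int :=
  match e with
  | ZVar j => (i == j)%:R
  | ZZero => 0
  | ZAdd e1 e2 => zcoef e1 i + zcoef e2 i
  | ZOpp e1 => - zcoef e1 i
  end.

Lemma zevalE (V : zmodType) (env : seq V) e :
  zeval env e = \sum_(i < size env) env`_i *~ zcoef e i.
Proof.
elim: e => [j||e1 IH1 e2 IH2|e IH] /=.
- have [ltj|gej] := ltnP j (size env).
    rewrite (bigD1 (Ordinal ltj)) //= eqxx big1 ?addr0// => i /eqP ne.
    by case: eqP => // ij; case: ne; apply: val_inj.
  rewrite nth_default// big1// => i _.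
  by rewrite ltn_eqF// (leq_trans (ltn_ord i)).
- by rewrite big1.
- by rewrite IH1 IH2 -big_split; apply: eq_bigr => i _; rewrite /= mulrzDr.
- by rewrite IH -sumrN; apply: eq_bigr => i _; rewrite mulrNz.
Qed.

Lemma zsolve (V : zmodType) (env : seq V) e1 e2 :
  all (fun i => zcoef e1 i == zcoef e2 i) (iota 0 (size env)) ->
  zeval env e1 = zeval env e2.
Proof.
move=> /allP h; rewrite !zevalE; apply: eq_bigr => i _.
by rewrite (eqP (h i _)) // mem_iota /= add0n.
Qed.

Ltac zmem x env :=
  match env with
  | nil => constr:(false)
  | ?y :: _ => let _ := match constr:(Set) with _ => unify x y end in constr:(true)
  | _ :: ?env' => zmem x env'
  end.

Ltac zindex x env :=
  match env with
  | ?y :: _ => let _ := match constr:(Set) with _ => unify x y end in constr:(0%N)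
  | _ :: ?env' => let n := zindex x env' in constr:(S n)
  end.

Ltac zvars env t :=
  match t with
  | @GRing.zero _ => env
  | @GRing.add _ ?a ?b => let env1 := zvars env a in zvars env1 b
  | @GRing.opp _ ?a => zvars env a
  | _ => match zmem t env with
         | true => env
         | false => constr:(t :: env)
         end
  end.

Ltac zreify env t :=
  match t with
  | @GRing.zero _ => constr:(ZZero)
  | @GRing.add _ ?a ?b =>
      let e1 := zreify env a in let e2 := zreify env b in constr:(ZAdd e1 e2)
  | @GRing.opp _ ?a => let e1 := zreify env a in constr:(ZOpp e1)
  | _ => let n := zindex t env in constr:(ZVar n)
  end.

Ltac zmod :=
  match goal with
  | |- @eq ?V ?a ?b =>
      let env0 := zvars (@nil V) a in
      let env := zvars env0 b in
      let e1 := zreify env a in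
      let e2 := zreify env b in
      exact: (@zsolve _ env e1 e2 isT)
  end.

(* The subquotient Z / B of V.  The coboundaries B are intersected with Z, which
   changes nothing for a complex: there B is contained in Z. *)
Section Subquotient.
Variables (V : zmodType) (Z B : zmodClosed V).

Record cocycle := Cocycle { cocycle_val : V; _ : cocycle_val \in Z }.
HB.instance Definition _ := [isSub for cocycle_val].
HB.instance Definition _ := [Choice of cocycle by <:].
HB.instance Definition _ := [SubChoice_isSubZmodule of cocycle by <:].

Definition coboundary : {pred cocycle} := [pred z : cocycle | val z \in B].

Lemma coboundary_zmod_closed : zmod_closed coboundary.
Proof.
split; first by rewrite inE raddf0 rpred0.
by move=> x y; rewrite !inE raddfB => *; rewrite rpredB.
Qed.
HB.instance Definition _ :=
  GRing.isZmodClosed.Build cocycle coboundary coboundary_zmod_closed.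

Definition cohomology := {ideal_quot coboundary}.

Definition cls (x : V) (xZ : x \in Z) : cohomology :=
  \pi_cohomology (Cocycle xZ).

Lemma cls_eqP (x y : V) (xZ : x \in Z) (yZ : y \in Z) :
  cls xZ = cls yZ <-> x - y \in B.
Proof. by split=> [/eqP|?]; [|apply/eqP]; rewrite -Quotient.idealrBE inE raddfB. Qed.

Lemma cls_reprK (u : cohomology) : cls (valP (repr u)) = u.
Proof. by rewrite -[RHS]reprK; congr (\pi _); apply: val_inj. Qed.

End Subquotient.

Section SubquotientMap.
Variables (V V' : zmodType) (Z B : zmodClosed V) (Z' B' : zmodClosed V').
Variables (phi : {additive V -> V'}).
Hypothesis phiZ : forall x, x \in Z -> phi x \in Z'.
Hypothesis phiB : forall x, x \in Z -> x \in B -> phi x \in B'.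

#[using="phiZ phiB"]
Definition cohomology_map (u : cohomology Z B) : cohomology Z' B' :=
  cls B' (phiZ (valP (repr u))).

Lemma cohomology_mapE (x : V) (xZ : x \in Z) :
  cohomology_map (cls B xZ) = cls B' (phiZ xZ).
Proof.
have /cls_eqP xB := cls_reprK (cls B xZ).
by apply/cls_eqP; rewrite -raddfB; apply: phiB => //; rewrite rpredB //; apply: valP.
Qed.

Lemma cohomology_map_additive : zmod_morphism cohomology_map.
Proof.
move=> u v; rewrite -[u]cls_reprK -[v]cls_reprK.
move: (valP (repr u)) (valP (repr v)) => /=.
move: (val (repr u)) (val (repr v)) => x y xZ yZ.
have clsB W (Y C : zmodClosed W) (a b : W) (aY : a \in Y) (bY : b \in Y) :
    cls C aY - cls C bY = cls C (rpredB aY bY).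
  by rewrite /cls -raddfB; congr (\pi _); apply: val_inj.
rewrite clsB !cohomology_mapE clsB.
by apply/cls_eqP; rewrite raddfB subrr rpred0.
Qed.
HB.instance Definition _ :=
  GRing.isZmodMorphism.Build _ _ cohomology_map cohomology_map_additive.

End SubquotientMap.
Arguments cohomology_map {V V' Z B Z' B' phi} phiZ phiB : rename.

Definition exact (U V W : zmodType) (f : {additive U -> V})
    (g : {additive V -> W}) : Prop :=
  forall v : V, g v = 0 <-> exists u : U, f u = v.

Section Complex.
Variables (C : nat -> zmodType) (d : forall n, {additive C n -> C n.+1}).

Definition complex_cocycles n : {pred C n} := [pred f | d n f == 0].

Definition is_coboundary n : C n -> Prop :=
  match n with
  | 0 => fun f => f = 0
  | n'.+1 => fun f => exists g : C n', f = d n' g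
  end.

Definition complex_coboundaries n : {pred C n} := [pred f | `[< is_coboundary f >]].

Lemma complex_cocycles_closed n : zmod_closed (@complex_cocycles n).
Proof.
split; first by rewrite inE raddf0.
by move=> f g; rewrite !inE raddfB /= => /eqP-> /eqP->; rewrite subr0.
Qed.
HB.instance Definition _ n :=
  GRing.isZmodClosed.Build (C n) (@complex_cocycles n) (@complex_cocycles_closed n).

Lemma complex_coboundaries_closed n : zmod_closed (@complex_coboundaries n).
Proof.
split; first by rewrite inE; apply/asboolP; case: n => //= n; exists 0; rewrite raddf0.
move=> f g; rewrite !inE => /asboolP + /asboolP + ; case: n f g => [|n] f g /=.
  by move=> -> ->; apply/asboolP; rewrite subr0.
by move=> [f' ->] [g' ->]; apply/asboolP; exists (f' - g'); rewrite raddfB.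
Qed.
HB.instance Definition _ n :=
  GRing.isZmodClosed.Build (C n) (@complex_coboundaries n)
    (@complex_coboundaries_closed n).

Definition complex_cohomology n :=
  cohomology (@complex_cocycles n) (@complex_coboundaries n).

End Complex.

Section GroupCohomology.
Variables (A N : zmodType).

Definition cochain (n : nat) : Type := n.-tuple A -> N.
HB.instance Definition _ n := GRing.Zmodule.on (cochain n).

(* The faces of (x_1, .., x_m), m = n + 1, are (x_2, .., x_m) for i = 0,
   (x_1, .., x_i + x_(i+1), .., x_m) for 0 < i < m, (x_1, .., x_n) for i = m;
   the tuple x is indexed from 0. *)
Definition face n (i : nat) (x : n.+1.-tuple A) : n.-tuple A :=
  [tuple if (j.+1 < i)%N then x`_j
         else if j.+1 == i then x`_j + x`_j.+1 else x`_j.+1 | j < n].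

Definition diff n (f : cochain n) : cochain n.+1 :=
  fun x => \sum_(i < n.+2) f (face i x) *~ (-1) ^+ i.

Lemma diff_additive n : zmod_morphism (@diff n).
Proof.
move=> f g; apply: funext => x; rewrite /diff -[RHS]/(_ - _) -sumrB.
by apply: eq_bigr => i _; rewrite -mulrzBl.
Qed.
HB.instance Definition _ n :=
  GRing.isZmodMorphism.Build (cochain n) (cochain n.+1) (@diff n) (@diff_additive n).

(* The cochains are not normalized: they need not vanish when an argument is 0. *)
Definition H n := complex_cohomology (C := cochain) diff n.

End GroupCohomology.

Section AbelianCohomology.
Variables (A N : zmodType).

Definition C1ab : Type := A -> N.
Definition C2ab : Type := A -> A -> N.
Definition C3ab : Type := ((A -> A -> A -> N) * (A -> A -> N))%type.
HB.instance Definition _ := GRing.Zmodule.on C1ab.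
HB.instance Definition _ := GRing.Zmodule.on C2ab.
HB.instance Definition _ := GRing.Zmodule.on C3ab.

Definition d1ab (g : C1ab) : C2ab := fun x y => g y - g (x + y) + g x.

Definition d2ab (f : C2ab) : C3ab :=
  (fun x y z => f y z - f (x + y) z + f x (y + z) - f x y,
   fun x y => f x y - f y x).

Lemma d1ab_additive : zmod_morphism d1ab.
Proof. by move=> f g; apply: eq2_fun => x y; rewrite /d1ab /= ?fctE; zmod. Qed.
HB.instance Definition _ := GRing.isZmodMorphism.Build C1ab C2ab d1ab d1ab_additive.

Lemma d2ab_additive : zmod_morphism d2ab.
Proof.
move=> f g; congr pair.
  by apply: eq3_fun => x y z; rewrite /= ?fctE; zmod.
by apply: eq2_fun => x y; rewrite /= ?fctE; zmod.
Qed.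
HB.instance Definition _ := GRing.isZmodMorphism.Build C2ab C3ab d2ab d2ab_additive.

Definition Z2ab : {pred C2ab} := [pred f | d2ab f == 0].
Definition B2ab : {pred C2ab} := [pred f | `[< exists g : C1ab, f = d1ab g >]].

Definition is_cocycle3ab (w : A -> A -> A -> N) (c : A -> A -> N) : Prop :=
  [/\ forall x y z t,
        w y z t - w (x + y) z t + w x (y + z) t - w x y (z + t) + w x y z = 0,
      forall x y z,
        c x z - c x (y + z) + c x y + w x y z - w y x z + w y z x = 0
    & forall x y z,
        c y z - c (x + y) z + c x z - w x y z + w x z y - w z x y = 0].

Definition Z3ab : {pred C3ab} := [pred u | `[< is_cocycle3ab u.1 u.2 >]].
Definition B3ab : {pred C3ab} := [pred u | `[< exists f : C2ab, u = d2ab f >]].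

Lemma Z2ab_closed : zmod_closed Z2ab.
Proof.
split; first by rewrite inE raddf0.
by move=> f g; rewrite !inE raddfB /= => /eqP-> /eqP->; rewrite subr0.
Qed.
HB.instance Definition _ := GRing.isZmodClosed.Build C2ab Z2ab Z2ab_closed.

Lemma B2ab_closed : zmod_closed B2ab.
Proof.
split; first by rewrite inE; apply/asboolP; exists 0; rewrite raddf0.
move=> f g; rewrite !inE => /asboolP[f' ->] /asboolP[g' ->].
by apply/asboolP; exists (f' - g'); rewrite raddfB.
Qed.
HB.instance Definition _ := GRing.isZmodClosed.Build C2ab B2ab B2ab_closed.

Lemma Z3ab_closed : zmod_closed Z3ab.
Proof.
split.
  rewrite inE; apply/asboolP; split=> *.
  - by rewrite -[LHS]/(0 - 0 + 0 - 0 + 0); zmod.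
  - by rewrite -[LHS]/(0 - 0 + 0 + 0 - 0 + 0); zmod.
  - by rewrite -[LHS]/(0 - 0 + 0 - 0 + 0 - 0); zmod.
move=> [w c] [w' c']; rewrite !inE => /asboolP[/= i1 i2 i3] /asboolP[/= j1 j2 j3].
apply/asboolP; split=> [x y z t|x y z|x y z] /=; rewrite ?fctE.
- by rewrite -[RHS](subrr 0) -{1}(i1 x y z t) -(j1 x y z t); zmod.
- by rewrite -[RHS](subrr 0) -{1}(i2 x y z) -(j2 x y z); zmod.
- by rewrite -[RHS](subrr 0) -{1}(i3 x y z) -(j3 x y z); zmod.
Qed.
HB.instance Definition _ := GRing.isZmodClosed.Build C3ab Z3ab Z3ab_closed.

Lemma B3ab_closed : zmod_closed B3ab.
Proof.
split; first by rewrite inE; apply/asboolP; exists 0; rewrite raddf0.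
move=> f g; rewrite !inE => /asboolP[f' ->] /asboolP[g' ->].
by apply/asboolP; exists (f' - g'); rewrite raddfB.
Qed.
HB.instance Definition _ := GRing.isZmodClosed.Build C3ab B3ab B3ab_closed.

Definition H2ab := cohomology Z2ab B2ab.
Definition H3ab := cohomology Z3ab B3ab.

End AbelianCohomology.

Section DoubleComplex.
Variables (A N : zmodType).

(* The group D^{p,q} for p, q > 0. *)
Definition bicochain (p q : nat) : Type := p.-tuple A -> q.-tuple A -> N.
HB.instance Definition _ p q := GRing.Zmodule.on (bicochain p q).

Definition dh p q (F : bicochain p q) : bicochain p.+1 q :=
  fun x y => diff (fun x' => F x' y) x.

Definition dv p q (F : bicochain p q) : bicochain p q.+1 :=
  fun x y => diff (F x) y.

(* The direct sum of the D^{p,q} with p + q = n; the zero summands (p = 0 or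
   q = 0) are left out, so that p and q below are shifted by one. *)
Definition tot (n : nat) : Type :=
  forall p q : nat, (p.+1 + q.+1)%N = n -> bicochain p.+1 q.+1.

HB.instance Definition _ n := gen_eqMixin (tot n).
HB.instance Definition _ n := gen_choiceMixin (tot n).

Lemma tot_ext n (F G : tot n) :
  (forall p q e x y, F p q e x y = G p q e x y) -> F = G.
Proof.
move=> h; apply: functional_extensionality_dep => p.
apply: functional_extensionality_dep => q; apply: funext => e.
by apply: eq2_fun => x y.
Qed.

Definition tot_zero n : tot n := fun p q e => 0.
Definition tot_opp n (F : tot n) : tot n := fun p q e => - F p q e.
Definition tot_add n (F G : tot n) : tot n := fun p q e => F p q e + G p q e.

Lemma tot_addA n : associative (@tot_add n).
Proof. by move=> F G K; apply: tot_ext => *; rewrite /tot_add addrA. Qed.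
Lemma tot_addC n : commutative (@tot_add n).
Proof. by move=> F G; apply: tot_ext => *; rewrite /tot_add addrC. Qed.
Lemma tot_add0 n : left_id (@tot_zero n) (@tot_add n).
Proof. by move=> F; apply: tot_ext => *; rewrite /tot_add add0r. Qed.
Lemma tot_addN n : left_inverse (@tot_zero n) (@tot_opp n) (@tot_add n).
Proof. by move=> F; apply: tot_ext => *; rewrite /tot_add addNr. Qed.
HB.instance Definition _ n := GRing.isZmodule.Build (tot n)
  (@tot_addA n) (@tot_addC n) (@tot_add0 n) (@tot_addN n).

(* The components of dtot F in D^{p,q} coming from D^{p-1,q} and D^{p,q-1}. *)
Definition dtot_h n (F : tot n) p q :
    (p.+1 + q.+1)%N = n.+1 -> bicochain p.+1 q.+1 :=
  match p with
  | 0 => fun _ => 0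
  | p'.+1 => fun e => dh (F p' q (succn_inj e))
  end.

Definition dtot_v n (F : tot n) p q :
    (p.+1 + q.+1)%N = n.+1 -> bicochain p.+1 q.+1 :=
  match q with
  | 0 => fun _ => 0
  | q'.+1 => fun e => dv (F p q' (succn_inj (etrans (esym (addnS _ _)) e)))
  end.

Definition dtot n (F : tot n) : tot n.+1 :=
  fun p q e x y => dtot_h F e x y + dtot_v F e x y *~ (-1) ^+ p.+1.

Lemma dtot_additive n : zmod_morphism (@dtot n).
Proof.
move=> F G; apply: tot_ext => p q e x y.
have hB : dtot_h (F - G) e x y = dtot_h F e x y - dtot_h G e x y.
  case: p e x => [|p] e x /=; first by rewrite ?fctE subr0.
  rewrite /dh -[RHS]/((diff (fun x' => F p q (succn_inj e) x' y)
    - diff (fun x' => G p q (succn_inj e) x' y)) x).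
  by rewrite -raddfB.
have vB : dtot_v (F - G) e x y = dtot_v F e x y - dtot_v G e x y.
  case: q e y {hB} => [|q] e y /=; first by rewrite ?fctE subr0.
  by rewrite /dv; set e' := succn_inj _; rewrite -[RHS]/((diff (F p q e' x)
    - diff (G p q e' x)) y) -raddfB.
rewrite /dtot hB vB mulrzBl.
rewrite -[RHS]/(_ + _ - (_ + _)); zmod.
Qed.
HB.instance Definition _ n :=
  GRing.isZmodMorphism.Build (tot n) (tot n.+1) (@dtot n) (@dtot_additive n).

Definition Htot n := complex_cohomology (C := tot) dtot n.

End DoubleComplex.
Section LowDegrees.
Variables (A N : zmodType).

Lemma tuple1E (x : 1.-tuple A) : x = [tuple x`_0].
Proof. by apply: eq_from_tnth => -[[|//] i]; rewrite !(tnth_nth 0). Qed.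
Lemma tuple2E (x : 2.-tuple A) : x = [tuple x`_0; x`_1].
Proof. by apply: eq_from_tnth => -[[|[|//]] i]; rewrite !(tnth_nth 0). Qed.
Lemma tuple3E (x : 3.-tuple A) : x = [tuple x`_0; x`_1; x`_2].
Proof. by apply: eq_from_tnth => -[[|[|[|//]]] i]; rewrite !(tnth_nth 0). Qed.
Lemma tuple4E (x : 4.-tuple A) : x = [tuple x`_0; x`_1; x`_2; x`_3].
Proof. by apply: eq_from_tnth => -[[|[|[|[|//]]]] i]; rewrite !(tnth_nth 0). Qed.

Lemma faceE n i (x : n.+1.-tuple A) (y : n.-tuple A) :
  (forall j, (j < n)%N -> y`_j = if (j.+1 < i)%N then x`_j
    else if j.+1 == i then x`_j + x`_j.+1 else x`_j.+1) -> face i x = y.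
Proof.
by move=> h; apply: eq_from_tnth => j; rewrite tnth_mktuple (tnth_nth 0) h.
Qed.

Lemma mulrz_signE (a : N) n : a *~ (-1) ^+ n = if odd n then - a else a.
Proof. by rewrite -signr_odd; case: odd; rewrite ?mulrN1z ?mulr1z. Qed.

Lemma diff1E (g : cochain A N 1) x y :
  diff g [tuple x; y] = g [tuple y] - g [tuple x + y] + g [tuple x].
Proof.
rewrite /diff !big_ord_recr big_ord0 /= add0r.
rewrite (@faceE 1 0 _ [tuple y]); last by case.
rewrite (@faceE 1 1 _ [tuple x + y]); last by case.
rewrite (@faceE 1 2 _ [tuple x]); last by case.
by rewrite !mulrz_signE.
Qed.

Lemma diff2E (f : cochain A N 2) x y z :
  diff f [tuple x; y; z] = f [tuple y; z] - f [tuple x + y; z]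
    + f [tuple x; y + z] - f [tuple x; y].
Proof.
rewrite /diff !big_ord_recr big_ord0 /= add0r.
rewrite (@faceE 2 0 _ [tuple y; z]); last by case=> [|[]].
rewrite (@faceE 2 1 _ [tuple x + y; z]); last by case=> [|[]].
rewrite (@faceE 2 2 _ [tuple x; y + z]); last by case=> [|[]].
rewrite (@faceE 2 3 _ [tuple x; y]); last by case=> [|[]].
by rewrite !mulrz_signE.
Qed.

Lemma diff3E (w : cochain A N 3) x y z t :
  diff w [tuple x; y; z; t] = w [tuple y; z; t] - w [tuple x + y; z; t]
    + w [tuple x; y + z; t] - w [tuple x; y; z + t] + w [tuple x; y; z].
Proof.
rewrite /diff !big_ord_recr big_ord0 /= add0r.
rewrite (@faceE 3 0 _ [tuple y; z; t]); last by case=> [|[|[]]].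
rewrite (@faceE 3 1 _ [tuple x + y; z; t]); last by case=> [|[|[]]].
rewrite (@faceE 3 2 _ [tuple x; y + z; t]); last by case=> [|[|[]]].
rewrite (@faceE 3 3 _ [tuple x; y; z + t]); last by case=> [|[|[]]].
rewrite (@faceE 3 4 _ [tuple x; y; z]); last by case=> [|[|[]]].
by rewrite !mulrz_signE.
Qed.

End LowDegrees.

Section Maps.
Variables (A N : zmodType).
Local Notation Z n := (complex_cocycles (C := cochain A N) (@diff A N) (n := n)).
Local Notation B n := (complex_coboundaries (C := cochain A N) (@diff A N) (n := n)).
Local Notation Ztot n := (complex_cocycles (C := tot A N) (@dtot A N) (n := n)).
Local Notation Btot n := (complex_coboundaries (C := tot A N) (@dtot A N) (n := n)).

Definition s2_cochain (f : C2ab A N) : cochain A N 2 := fun x => f x`_0 x`_1.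

Lemma s2_cochain_additive : zmod_morphism s2_cochain.
Proof. by []. Qed.
HB.instance Definition _ := GRing.isZmodMorphism.Build
  (C2ab A N) (cochain A N 2) s2_cochain s2_cochain_additive.

Lemma s2_cocycle f : f \in @Z2ab A N ->
  s2_cochain f \in Z 2.
Proof.
rewrite !inE => /eqP[f0 _]; apply/eqP/funext => x.
rewrite [x]tuple3E -[LHS]/(diff (s2_cochain f) _) diff2E.
exact: (congr1 (fun g => g x`_0 x`_1 x`_2) f0).
Qed.

Lemma s2_coboundary f : f \in @Z2ab A N -> f \in @B2ab A N ->
  s2_cochain f \in B 2.
Proof.
rewrite !inE => _ /asboolP[g ->]; apply/asboolP.
exists (fun x => g x`_0); apply: funext => x.
by rewrite [x]tuple2E -[RHS]/(diff _ _) diff1E.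
Qed.

Definition s2 : {additive H2ab A N -> H A N 2} :=
  cohomology_map s2_cocycle s2_coboundary.

Definition s3_cochain (u : C3ab A N) : cochain A N 3 :=
  fun x => u.1 x`_0 x`_1 x`_2.

Lemma s3_cochain_additive : zmod_morphism s3_cochain.
Proof. by []. Qed.
HB.instance Definition _ := GRing.isZmodMorphism.Build
  (C3ab A N) (cochain A N 3) s3_cochain s3_cochain_additive.

Lemma s3_cocycle u : u \in @Z3ab A N ->
  s3_cochain u \in Z 3.
Proof.
rewrite !inE => /asboolP[w0 _ _]; apply/eqP/funext => x.
by rewrite [x]tuple4E -[LHS]/(diff (s3_cochain u) _) diff3E; apply: w0.
Qed.

Lemma s3_coboundary u : u \in @Z3ab A N -> u \in @B3ab A N ->
  s3_cochain u \in B 3.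
Proof.
rewrite !inE => _ /asboolP[f ->]; apply/asboolP.
exists (s2_cochain f); apply: funext => x.
by rewrite [x]tuple3E -[RHS]/(diff _ _) diff2E.
Qed.

Definition s3 : {additive H3ab A N -> H A N 3} :=
  cohomology_map s3_cocycle s3_coboundary.

(* Tot^2 has the single component D^{1,1} (p = q = 0 below), and the 2-cocycles
   are the bilinear maps A x A -> N: see tot2_cocycleP. *)
Definition iota_cochain (F : tot A N 2) : C3ab A N :=
  (0, fun x y => F 0%N 0%N erefl [tuple x] [tuple y]).

Lemma iota_cochain_additive : zmod_morphism iota_cochain.
Proof.
by move=> F G; congr pair; apply: eq3_fun => x y z; rewrite /= ?fctE; zmod.
Qed.
HB.instance Definition _ := GRing.isZmodMorphism.Build
  (tot A N 2) (C3ab A N) iota_cochain iota_cochain_additive.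

Lemma dtot2_01 (F : tot A N 2) (e : (1 + 2)%N = 3%N) x y z :
  let c x y := F 0%N 0%N erefl [tuple x] [tuple y] in
  dtot F (p := 0) (q := 1) e [tuple x] [tuple y; z] = - (c x z - c x (y + z) + c x y).
Proof.
rewrite /dtot /= /dv (eq_irrelevance (succn_inj _) erefl) diff1E mulrN1z.
by rewrite -[LHS]/(0 + _) add0r.
Qed.

Lemma dtot2_10 (F : tot A N 2) (e : (2 + 1)%N = 3%N) x y z :
  let c x y := F 0%N 0%N erefl [tuple x] [tuple y] in
  dtot F (p := 1) (q := 0) e [tuple x; y] [tuple z] = c y z - c (x + y) z + c x z.
Proof.
rewrite /dtot /= /dh (eq_irrelevance (succn_inj _) erefl) diff1E mul0rz.
by rewrite addr0.
Qed.

Lemma tot3_ext (F G : tot A N 3) :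
  (forall e x y z, F 0%N 1%N e [tuple x] [tuple y; z] = G 0%N 1%N e [tuple x] [tuple y; z]) ->
  (forall e x y z, F 1%N 0%N e [tuple x; y] [tuple z] = G 1%N 0%N e [tuple x; y] [tuple z]) ->
  F = G.
Proof.
move=> h1 h2; apply: tot_ext => -[|[|p]] [|[|q]] e x y;
  try by move/eqP: (e); rewrite ?addnS.
- by rewrite [x]tuple1E [y]tuple2E h1.
- by rewrite [x]tuple2E [y]tuple1E h2.
Qed.

Lemma tot2_cocycleP (F : tot A N 2) :
  F \in Ztot 2 ->
  let c x y := F 0%N 0%N erefl [tuple x] [tuple y] in
  (forall x y z, c x (y + z) = c x y + c x z) /\
  (forall x y z, c (x + y) z = c x z + c y z).
Proof.
rewrite inE => /eqP F0 c; split=> x y z.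
  have := congr1 (fun G : tot A N 3 => G 0%N 1%N erefl [tuple x] [tuple y; z]) F0.
  rewrite /= dtot2_01 -/(c _ _) -/(c _ _) -/(c _ _) -[RHS]/(0 : N) => h.
  by apply/eqP; rewrite -subr_eq0; apply/eqP; rewrite -h; zmod.
have := congr1 (fun G : tot A N 3 => G 1%N 0%N erefl [tuple x; y] [tuple z]) F0.
rewrite /= dtot2_10 -/(c _ _) -/(c _ _) -/(c _ _) -[RHS]/(0 : N) => h.
by apply/eqP; rewrite eq_sym -subr_eq0; apply/eqP; rewrite -h; zmod.
Qed.

Lemma iota_cocycle F :
  F \in Ztot 2 ->
  iota_cochain F \in @Z3ab A N.
Proof.
move=> /tot2_cocycleP[cr cl]; rewrite inE; apply/asboolP.
split=> [x y z t|x y z|x y z] /=.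
- by rewrite -[LHS]/(0 - 0 + 0 - 0 + 0); zmod.
- rewrite cr; set a := F _ _ _ _ _; set b := F _ _ _ _ _.
  by rewrite -[LHS]/(a - (b + a) + b + 0 - 0 + 0); zmod.
- rewrite cl; set a := F _ _ _ _ _; set b := F _ _ _ _ _.
  by rewrite -[LHS]/(a - (b + a) + b - 0 + 0 - 0); zmod.
Qed.

Lemma iota_coboundary F :
  F \in Ztot 2 ->
  F \in Btot 2 ->
  iota_cochain F \in @B3ab A N.
Proof.
rewrite !inE => _ /asboolP[G ->]; apply/asboolP; exists 0; rewrite raddf0.
congr pair; apply: eq2_fun => x y.
by rewrite -[LHS]/((0 : N) + 0 *~ (-1) ^+ 1) mul0rz addr0.
Qed.

Definition iota_ab : {additive Htot A N 2 -> H3ab A N} :=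
  cohomology_map iota_cocycle iota_coboundary.

Definition tau2_cochain (a : cochain A N 2) : tot A N 2 :=
  fun _ _ _ x y => a [tuple x`_0; y`_0] - a [tuple y`_0; x`_0].

Lemma tau2_cochain_additive : zmod_morphism tau2_cochain.
Proof.
move=> a b; apply: tot_ext => p q e x y.
rewrite -[RHS]/(tau2_cochain a e x y - tau2_cochain b e x y) /tau2_cochain ?fctE.
zmod.
Qed.
HB.instance Definition _ := GRing.isZmodMorphism.Build
  (cochain A N 2) (tot A N 2) tau2_cochain tau2_cochain_additive.

Lemma tau2_cochainE (a : cochain A N 2) e x y :
  tau2_cochain a (p := 0) (q := 0) e [tuple x] [tuple y] =
  a [tuple x; y] - a [tuple y; x].
Proof. by []. Qed.

Lemma tau2_cocycle a :
  a \in Z 2 ->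
  tau2_cochain a \in Ztot 2.
Proof.
rewrite !inE => /eqP a0.
have K x y z : _ = 0 :> N := etrans (esym (diff2E a x y z)) (congr1 (@^~ _) a0).
apply/eqP/tot3_ext => e x y z.
- rewrite -[LHS]/(dtot (tau2_cochain a) e _ _) dtot2_01 !tau2_cochainE -[RHS]/(0 : N).
  transitivity (0 - 0 + 0 : N); last by zmod.
  rewrite -{1}(K x y z) -{1}(K y x z) -(K y z x) (addrC y x) (addrC z x).
  zmod.
- rewrite -[LHS]/(dtot (tau2_cochain a) e _ _) dtot2_10 !tau2_cochainE -[RHS]/(0 : N).
  transitivity (0 - 0 + 0 : N); last by zmod.
  rewrite -{1}(K x y z) -{1}(K x z y) -(K z x y) (addrC z x) (addrC z y).
  zmod.
Qed.

Lemma tau2_coboundary a : a \in Z 2 -> a \in B 2 -> tau2_cochain a \in Btot 2.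
Proof.
rewrite !inE => _ /asboolP[g ->]; apply/asboolP; exists 0; rewrite raddf0.
apply: tot_ext => p q e x y; rewrite /tau2_cochain /= !diff1E.
by rewrite (addrC y`_0) -[RHS]/(0 : N); zmod.
Qed.

Definition tau2 : {additive H A N 2 -> Htot A N 2} :=
  cohomology_map tau2_cocycle tau2_coboundary.

(* Tot^3 has the components D^{1,2} (p = 0 and q = 1 below) and D^{2,1}
   (p = 1 and q = 0 below). *)
Definition alpha (w : cochain A N 3) (x y z : A) : N :=
  w [tuple x; y; z] - w [tuple y; x; z] + w [tuple y; z; x].

Definition beta (w : cochain A N 3) (x y z : A) : N :=
  w [tuple x; y; z] - w [tuple x; z; y] + w [tuple z; x; y].

Definition tau3_cochain (w : cochain A N 3) : tot A N 3 :=
  fun p _ _ x y =>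
    if p is 0 then alpha w x`_0 y`_0 y`_1 else beta w x`_0 x`_1 y`_0.

Lemma tau3_cochain01 (w : cochain A N 3) e x y z :
  tau3_cochain w (p := 0) (q := 1) e [tuple x] [tuple y; z] = alpha w x y z.
Proof. by []. Qed.

Lemma tau3_cochain10 (w : cochain A N 3) e x y z :
  tau3_cochain w (p := 1) (q := 0) e [tuple x; y] [tuple z] = beta w x y z.
Proof. by []. Qed.

Lemma tau3_cochain_additive : zmod_morphism tau3_cochain.
Proof.
move=> a b; apply: tot3_ext => e x y z.
- rewrite -[RHS]/(alpha a x y z - alpha b x y z).
  by rewrite tau3_cochain01 /alpha ?fctE; zmod.
- rewrite -[RHS]/(beta a x y z - beta b x y z).
  by rewrite tau3_cochain10 /beta ?fctE; zmod.
Qed.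
HB.instance Definition _ := GRing.isZmodMorphism.Build
  (cochain A N 3) (tot A N 3) tau3_cochain tau3_cochain_additive.

Lemma tau3_coboundary w : w \in Z 3 -> w \in B 3 -> tau3_cochain w \in Btot 3.
Proof.
rewrite !inE => _ /asboolP[f ->]; apply/asboolP; exists (tau2_cochain f).
apply: tot3_ext => e x y z.
- rewrite -[LHS]/(alpha (diff f) x y z) -[RHS]/(dtot (tau2_cochain f) e _ _) dtot2_01 !tau2_cochainE /alpha !diff2E (addrC y x) (addrC z x).
  by zmod.
- rewrite -[LHS]/(beta (diff f) x y z) -[RHS]/(dtot (tau2_cochain f) e _ _) dtot2_10 !tau2_cochainE /beta !diff2E (addrC z x) (addrC z y).
  by zmod.
Qed.

Lemma tau3_cocycle w : w \in Z 3 -> tau3_cochain w \in Ztot 3.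
Proof.
rewrite !inE => /eqP w0; apply/eqP.
have K x y z t : _ = 0 :> N := etrans (esym (diff3E w x y z t)) (congr1 (@^~ _) w0).
apply: tot_ext => -[|[|[|p]]] [|[|[|q]]] e x y;
  try by move/eqP: (e); rewrite ?addnS.
- rewrite [x]tuple1E [y]tuple3E; move: (x`_0) (y`_0) (y`_1) (y`_2) => {x y} x y z t.
  rewrite -[LHS]/(dtot (tau3_cochain w) e _ _) /dtot /= /dv diff2E !tau3_cochain01 /alpha.
  rewrite -[LHS]/((0 : N) + _) add0r -[RHS]/(0 : N) mulrN1z.
  transitivity (0 - 0 + 0 - 0 : N); last by zmod.
  rewrite -{1}(K x y z t) -{1}(K y x z t) -{1}(K y z x t) -(K y z t x).
  rewrite (addrC y x) (addrC z x) (addrC t x).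
  by zmod.
- rewrite [x]tuple2E [y]tuple2E; move: (x`_0) (x`_1) (y`_0) (y`_1) => {x y} x y z t.
  rewrite -[LHS]/(dtot (tau3_cochain w) e _ _) /dtot /= /dh /dv !diff1E.
  rewrite !tau3_cochain01 !tau3_cochain10 mulrz_signE /= /alpha /beta -[RHS]/(0 : N).
  transitivity (0 - 0 + 0 + 0 - 0 + 0 : N); last by zmod.
  rewrite -{1}(K x y z t) -{1}(K x z y t) -{1}(K x z t y).
  rewrite -{1}(K z x y t) -{1}(K z x t y) -(K z t x y).
  rewrite (addrC z x) (addrC z y) (addrC t x) (addrC t y).
  by zmod.
- rewrite [x]tuple3E [y]tuple1E; move: (x`_0) (x`_1) (x`_2) (y`_0) => {x y} x y z t.
  rewrite -[LHS]/(dtot (tau3_cochain w) e _ _) /dtot /= /dh diff2E.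
  rewrite !tau3_cochain10 mulrz_signE /= /beta -[RHS]/(0 : N).
  transitivity (0 - 0 + 0 - 0 : N); last by zmod.
  rewrite -{1}(K x y z t) -{1}(K x y t z) -{1}(K x t y z) -(K t x y z).
  rewrite (addrC t x) (addrC t y) (addrC t z).
  rewrite -[X in _ - X]/(0 : N).
  by zmod.
Qed.

Definition tau3 : {additive H A N 3 -> Htot A N 3} :=
  cohomology_map tau3_cocycle tau3_coboundary.

End Maps.

Arguments s2 : clear implicits.
Arguments s3 : clear implicits.
Arguments iota_ab : clear implicits.
Arguments tau2 : clear implicits.
Arguments tau3 : clear implicits.

(* Main.v *)
(* The cocycle conditions (ii) and (iii) say that tau_3 of omega is the
   coboundary of c in the total complex, and the antisymmetrization of f is both
   c_f and tau_2 f.  Hence at each spot a cochain witnessing that the image is a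
   coboundary is exactly the missing component of a preimage; at H^3_ab,
   subtracting the coboundary of f from (omega_f, c) leaves (0, c - c_f), and
   (ii) and (iii) for (omega_f, c) make c - c_f bilinear. *)
Require Import Defs.
From mathcomp Require Import all_boot all_order all_algebra.
From mathcomp Require Import boolp functions.

Set Implicit Arguments.
Unset Strict Implicit.
Unset Printing Implicit Defensive.
Import GRing.Theory.
Local Open Scope ring_scope.
Local Open Scope quotient_scope.

Lemma cls_eq0P (V : zmodType) (Z B : zmodClosed V) (x : V) (xZ : x \in Z) :
  cls B xZ = 0 <-> x \in B.
Proof.
have <- : cls B (rpred0 Z) = 0.
  rewrite -[RHS](subrr (cls B (rpred0 Z))) /cls -raddfB subrr.
  by congr (\pi _); apply: val_inj.
by split=> [/cls_eqP|xB]; [|apply/cls_eqP]; rewrite subr0.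
Qed.

(** Reduces exactness on classes to two statements about cocycles. A preimage is needed only up to a
    coboundary, since [cls_eqP] then identifies the classes. *)
Lemma exact_cohomology_map (U V W : zmodType)
    (ZU BU : zmodClosed U) (ZV BV : zmodClosed V) (ZW BW : zmodClosed W)
    (f : {additive U -> V}) (g : {additive V -> W})
    (fZ : forall x, x \in ZU -> f x \in ZV)
    (fB : forall x, x \in ZU -> x \in BU -> f x \in BV)
    (gZ : forall x, x \in ZV -> g x \in ZW)
    (gB : forall x, x \in ZV -> x \in BV -> g x \in BW) :
  (forall u, u \in ZU -> g (f u) \in BW) ->
  (forall v, v \in ZV -> g v \in BW -> exists2 u, u \in ZU & f u - v \in BV) ->
  exact (cohomology_map fZ fB) (cohomology_map gZ gB).
Proof.
move=> gf0 ker v; rewrite -[v]cls_reprK; move: (valP (repr v)) => /=.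
move: (val _) => {v} v vZ; rewrite cohomology_mapE cls_eq0P; split.
  move=> /(ker _ vZ)[u uZ uv]; exists (cls BU uZ).
  by rewrite cohomology_mapE; apply/cls_eqP.
move=> [u]; rewrite -[u]cls_reprK; move: (valP (repr u)) => /=.
move: (val _) => {u} u uZ; rewrite cohomology_mapE => /cls_eqP uv.
have := gB _ (rpredB (fZ _ uZ) vZ) uv.
(* [g v] is [g (f u)] minus [g (f u - v)], and both lie in [BW]. *)
by rewrite raddfB => guv; rewrite -[g v](subKr (g (f u))) rpredB ?gf0.
Qed.

Lemma cochain2E (A N : zmodType) (a : cochain A N 2) :
  a = s2_cochain (fun x y => a [tuple x; y]).
Proof. by apply: funext => x; rewrite {1}[x]tuple2E. Qed.

Lemma cochain3E (A N : zmodType) (w : cochain A N 3) c :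
  w = s3_cochain (fun x y z => w [tuple x; y; z], c).
Proof. by apply: funext => x; rewrite {1}[x]tuple3E. Qed.

(** [Tot^1] vanishes: in bidegree (1,1) both incoming components of [dtot] are zero by definition. A
    zero class in degree 2 is therefore a zero cochain. *)
Lemma tot2_coboundary_eq0 (A N : zmodType) (F : tot A N 2) :
  F \in complex_coboundaries (C := tot A N) (@dtot A N) (n := 2) -> F = 0.
Proof.
rewrite inE => /asboolP[G ->]; apply: tot_ext => -[|p] [|q] e x y;
  try by move/eqP: (e); rewrite ?addnS.
by rewrite -[LHS]/((0 : N) + 0 *~ (-1) ^+ 1) mul0rz addr0.
Qed.

(** The indices can be ignored: the degree condition leaves only [p = q = 0], where each tuple has
    one entry. *)
Definition tot2_of (A N : zmodType) (c : A -> A -> N) : tot A N 2 :=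
  fun _ _ _ x y => c x`_0 y`_0.

Lemma tot2_of_cocycle (A N : zmodType) (c : A -> A -> N) :
  (forall x y z, c x z - c x (y + z) + c x y = 0) ->
  (forall x y z, c y z - c (x + y) z + c x z = 0) ->
  tot2_of c \in complex_cocycles (C := tot A N) (@dtot A N) (n := 2).
Proof.
move=> cr cl; rewrite inE; apply/eqP/tot3_ext => e x y z.
- by rewrite -[LHS]/(dtot _ _ _ _) dtot2_01 /tot2_of /= cr oppr0.
- by rewrite -[LHS]/(dtot _ _ _ _) dtot2_10 /tot2_of /= cl.
Qed.

(** The two theories have the same coboundaries of 1-cochains, so a function bounding [f] in one
    bounds it in the other. *)
Lemma s2_injective (A N : zmodType) : injective (s2 A N).
Proof.
apply: raddf_inj => u; rewrite -[u]cls_reprK; move: (valP (repr u)) => /=.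
move: (val _) => {u} f fZ; rewrite cohomology_mapE => /cls_eq0P.
rewrite inE => /asboolP[g fg]; apply/cls_eq0P; rewrite inE; apply/asboolP.
exists (fun x => g [tuple x]); apply: eq2_fun => x y.
by rewrite -[LHS]/(s2_cochain f [tuple x; y]) fg -[LHS]/(diff _ _) diff1E.
Qed.

Lemma exact_s2_tau2 (A N : zmodType) : exact (s2 A N) (tau2 A N).
Proof.
apply: exact_cohomology_map => [f|a].
  rewrite inE => /eqP[_ fC].
  suff fC0 : tau2_cochain (s2_cochain f) = 0 by rewrite /= fC0 rpred0.
  by apply: tot_ext => p q e x y; exact: (congr1 (fun c => c x`_0 y`_0) fC).
rewrite inE => /eqP aZ /tot2_coboundary_eq0 aC.
exists (fun x y => a [tuple x; y]); last by rewrite /= -cochain2E subrr rpred0.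
rewrite inE; apply/eqP; congr pair.
  apply: eq3_fun => x y z; rewrite -diff2E.
  exact: (congr1 (@^~ [tuple x; y; z]) aZ).
apply: eq2_fun => x y.
exact: (congr1 (fun F : tot A N 2 => F 0 0 erefl [tuple x] [tuple y]) aC).
Qed.

Lemma exact_tau2_iota (A N : zmodType) : exact (tau2 A N) (iota_ab A N).
Proof.
apply: exact_cohomology_map => [a|F FZ].
  rewrite !inE => /eqP aZ; apply/asboolP.
  exists (fun x y => a [tuple x; y]); congr pair.
  (* The second components agree by computation; what remains is that [a] is a cocycle. *)
  apply: eq3_fun => x y z; rewrite -diff2E.
  by rewrite -[diff a]/(@diff A N 2 a) aZ.
rewrite inE => /asboolP[f [fZ fF]]; exists (s2_cochain f).
  rewrite inE; apply/eqP/funext => x; rewrite [x]tuple3E.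
  rewrite -[LHS]/(diff _ _) diff2E.
  exact: (congr1 (fun w => w x`_0 x`_1 x`_2) (esym fZ)).
suff afF : tau2_cochain (s2_cochain f) = F by rewrite /= afF subrr rpred0.
apply: tot_ext => -[|p] [|q] e x y; try by move/eqP: (e); rewrite ?addnS.
rewrite [x]tuple1E [y]tuple1E (eq_irrelevance e erefl).
exact: (congr1 (fun c => c x`_0 y`_0) (esym fF)).
Qed.

Lemma exact_iota_s3 (A N : zmodType) : exact (iota_ab A N) (s3 A N).
Proof.
apply: exact_cohomology_map => [F _|[w c] wcZ].
  have sF : s3_cochain (iota_cochain F) = 0 by apply: funext.
  by rewrite /= sF rpred0.
rewrite inE => /asboolP[a wa].
pose f x y := a [tuple x; y].
have wf : w = (d2ab (f : C2ab A N)).1.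
  apply: eq3_fun => x y z; rewrite /= -diff2E.
  exact: (congr1 (@^~ [tuple x; y; z]) wa).
rewrite wf in wcZ *; move: wcZ; rewrite inE => /asboolP[_ /= cr cl].
exists (tot2_of (fun x y => c x y - (f x y - f y x))).
  apply: tot2_of_cocycle => x y z.
    (* Commutativity of [A] makes the arguments of [f] match syntactically; [zmod] treats the values
       of [f] as atoms. *)
    by rewrite -[RHS](cr x y z) (addrC y x) (addrC z x); zmod.
  by rewrite -[RHS](cl x y z) (addrC z x) (addrC z y); zmod.
(* The difference is [(0, c - c_f) - (omega_f, c)], hence minus the coboundary of [f]. *)
rewrite inE; apply/asboolP; exists (- (f : C2ab A N)); rewrite raddfN.
congr pair; first by apply: eq3_fun => x y z; rewrite -[LHS]/(0 - _) sub0r.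
by apply: eq2_fun => x y; rewrite -[LHS]/(_ - _ - _) -[RHS]/(- (_ - _)) /=; zmod.
Qed.

(** The signs match: [dtot] carries -1 on the vertical differential of [D^{1,1}], while [alpha]
    enters (ii) with a plus and [beta] enters (iii) with a minus. So the same [c] serves in both
    directions. *)
Lemma exact_s3_tau3 (A N : zmodType) : exact (s3 A N) (tau3 A N).
Proof.
apply: exact_cohomology_map => [[w c]|w].
  rewrite !inE => /asboolP[/= _ wr wl]; apply/asboolP; exists (tot2_of c).
  apply: tot3_ext => e x y z.
  - rewrite -[RHS]/(dtot _ _ _ _) dtot2_01 tau3_cochain01 /alpha /tot2_of /=.
    apply/eqP; rewrite -subr_eq0 -(wr x y z); apply/eqP; rewrite /s3_cochain /=; zmod.
  - rewrite -[RHS]/(dtot _ _ _ _) dtot2_10 tau3_cochain10 /beta /tot2_of /=.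
    apply/eqP; rewrite eq_sym -subr_eq0 -(wl x y z); apply/eqP.
    by rewrite /s3_cochain /=; zmod.
rewrite !inE => /eqP wZ /asboolP[F wF].
pose c x y := F 0 0 erefl [tuple x] [tuple y].
exists ((fun x y z => w [tuple x; y; z]), c); last by rewrite /= -cochain3E subrr rpred0.
rewrite inE; apply/asboolP; split=> [x y z t|x y z|x y z] /=.
- by rewrite -diff3E; exact: (congr1 (@^~ [tuple x; y; z; t]) wZ).
- have : alpha w x y z = dtot F (p := 0) (q := 1) erefl [tuple x] [tuple y; z].
    exact: (congr1 (fun G : tot A N 3 => G 0 1 erefl [tuple x] [tuple y; z]) wF).
  by rewrite dtot2_01 => /eqP; rewrite -subr_eq0 => /eqP <-; rewrite /alpha /c; zmod.
- have : beta w x y z = dtot F (p := 1) (q := 0) erefl [tuple x; y] [tuple z].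
    exact: (congr1 (fun G : tot A N 3 => G 1 0 erefl [tuple x; y] [tuple z]) wF).
  rewrite dtot2_10 => /eqP; rewrite eq_sym -subr_eq0 => /eqP <-.
  by rewrite /beta /c; zmod.
Qed.

Theorem theorem4p5 (A N : zmodType) :
  [/\ injective (s2 A N),
      exact (s2 A N) (tau2 A N),
      exact (tau2 A N) (iota_ab A N),
      exact (iota_ab A N) (s3 A N)
    & exact (s3 A N) (tau3 A N)].
Proof.
split; [exact: s2_injective | exact: exact_s2_tau2 | exact: exact_tau2_iota
  | exact: exact_iota_s3 | exact: exact_s3_tau3].
Qed.
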